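(* The minimum density of a vertex identifying code for the infinite hexagonal grid $G_H$ is at least $5/12$; that is, $\sigma_0(G_H) \geq \frac{5}{12}$.
   Context: $G_H$ denotes the infinite hexagonal (honeycomb) grid, i.e. the infinite $3$-regular planar graph formed by the vertices and edges of the tiling of the plane by regular hexagons (concretely, up to isomorphism: vertex set $\mathbb{Z}^2$, with $(i,j)$ adjacent to $(i\pm 1,j)$, and $(i,j)$ adjacent to $(i,j+1)$ whenever $i+j$ is even). For a vertex $v$, $N_i(v)$ is the set of vertices at distance exactly $i$ from $v$ (so $N_0(v)=\{v\}$), and $N[v]=N_1(v)\cup\{v\}$. A set $D\subseteq V(G)$ is a vertex identifying code for a graph $G$ if (i) $N[v]\cap D\neq\emptyset$ for all $v\in V(G)$, and (ii) $N[v_1]\cap D\neq N[v_2]\cap D$ for all distinct $v_1,v_2\in V(G)$. For a vertex identifying code $D$ of an infinite graph $G$, its density is $$\sigma(D,G)=\limsup_{k\to\infty}\frac{\left|\bigcup_{i=0}^{k}N_i(v)\cap D\right|}{\left|\bigcup_{i=0}^{k}N_i(v)\right|}$$ for some vertex $v\in V(G)$, and $\sigma_0(G)=\min_D\{\sigma(D,G)\}$, over all vertex identifying codes $D$ for $G$ (so a lower bound on $\sigma_0(G)$ is a lower bound on $\sigma(D,G)$ for every such $D$). *)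

(* Defs.v *)
From HB Require Import structures.
From mathcomp Require Import all_boot all_order all_algebra finmap.
From mathcomp Require Import all_classical all_reals all_analysis.

Set Implicit Arguments.
Unset Strict Implicit.
Unset Printing Implicit Defensive.

Import Order.TTheory GRing.Theory Num.Theory.

Local Open Scope classical_set_scope.
Local Open Scope ring_scope.

Section IdentifyingCodes.
Variables (V : choiceType) (e : rel V).

(* [path e v p] is the walk v :: p; its length is the size of p. *)
Definition sphere (i : nat) (v : V) : set V :=
  [set w | (exists p : seq V, [/\ path e v p, last v p = w & size p = i]) /\
           (forall p : seq V, path e v p -> last v p = w -> (i <= size p)%N)].

Definition ball_upto (k : nat) (v : V) : set V :=
  \bigcup_(i < k.+1) sphere i v.

Definition closed_neighborhood (v : V) : set V := sphere 1 v `|` [set v].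

Definition identifying_code (D : set V) : Prop :=
  (forall v, closed_neighborhood v `&` D !=set0) /\
  (forall v1 v2, v1 <> v2 ->
     closed_neighborhood v1 `&` D <> closed_neighborhood v2 `&` D).

(* [fset_set] sends infinite sets to the empty fset, so the ratios below have
   their intended meaning only when all balls of e are finite, e.g. when e is
   locally finite, as is the hexagonal grid. *)
Definition code_density (R : realType) (D : set V) (v : V) : \bar R :=
  limn_esup (fun k =>
    (#|` fset_set (ball_upto k v `&` D)|%:R /
     #|` fset_set (ball_upto k v)|%:R : R)%:E).

(* The infimum over all codes is always defined, whether or not it is
   attained; when it is, it is the minimum. *)
Definition min_code_density (R : realType) (v : V) : \bar R :=
  ereal_inf [set code_density R D v | D in identifying_code].

End IdentifyingCodes.

Definition hex_up (u v : int * int) : bool :=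
  [&& v.1 == u.1, v.2 == u.2 + 1 & (2 %| u.1 + u.2)%Z].

Definition hex_grid : rel (int * int) := fun u v =>
  [|| (v.2 == u.2) && ((v.1 == u.1 + 1) || (v.1 == u.1 - 1)),
      hex_up u v | hex_up v u].

(* Main.v *)
(* The proof is a discharging argument found by linear programming. Start with charge 72 on
   every vertex of the code D and 0 elsewhere, and let charge flow between vertices at distance
   at most 2, the amount depending only on D near the two ends, in such a way that every vertex
   ends with at least 30 = 72 * 5/12. What a finite ball can gain crosses its boundary, so
   30 |B_k| <= 72 |D cap B_k| + C (|B_(k+r)| - |B_k|). If D had density below 5/12, the last
   term would be at least a fixed fraction of |B_k| for all large k, and |B_k| would grow
   exponentially, whereas it is at most (2k+1)^2.

   The grid is a Cayley graph: Z^2 with the twisted product (a,b)(c,d) = (a+c, b +- d), the sign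
   being (-1)^(a+b), acts simply transitively, and the neighbours of x are x(1,0), x(-1,0) and
   x(0,1). Hence a flow rule read in the frame of its source is automatically conservative, and
   the local inequality only has to be checked at the identity, for all D satisfying the
   identifying-code conditions nearby. There it is a statement about a sum of decision trees,
   decided by branch and bound. *)

Require Import Defs.
From Stdlib Require Import ZArith FMapPositive.
From mathcomp Require Import all_boot all_order all_algebra finmap.
From mathcomp Require Import all_classical all_reals all_analysis.
From mathcomp Require Import zify ssrZ ring lra.

Set Implicit Arguments.
Unset Strict Implicit.
Unset Printing Implicit Defensive.

Import Order.TTheory GRing.Theory Num.Theory.

(** * The hexagonal grid as a group *)

Definition pos := (Z * Z)%type.

Definition pmul (x g : pos) : pos :=
  (Z.add x.1 g.1, if Z.even (Z.add x.1 x.2) then Z.add x.2 g.2 else Z.sub x.2 g.2).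

Definition pinv (g : pos) : pos :=
  (Z.opp g.1, if Z.even (Z.add g.1 g.2) then Z.opp g.2 else g.2).

Definition pone : pos := (Z0, Z0).

Lemma evenD (a b : Z) : Z.even (Z.add a b) = (Z.even a == Z.even b).
Proof. by rewrite Z.even_add; case: (Z.even a); case: (Z.even b). Qed.

Lemma evenB (a b : Z) : Z.even (Z.sub a b) = (Z.even a == Z.even b).
Proof. by rewrite Z.even_sub; case: (Z.even a); case: (Z.even b). Qed.

Lemma pmulA (x y z : pos) : pmul (pmul x y) z = pmul x (pmul y z).
Proof.
case: x y z => [a b] [c d] [e f]; rewrite /pmul /=.
(* Signs do not affect parity, so the parity of the coordinate sum is a homomorphism to Z/2; this
   makes the twists compose. *)
have E : Z.even (Z.add (Z.add a c) (if Z.even (Z.add a b) then Z.add b d else Z.sub b d))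
  = (Z.even (Z.add a b) == Z.even (Z.add c d)).
  case: ifP; rewrite !(evenD, evenB);
    by case: (Z.even a); case: (Z.even b); case: (Z.even c); case: (Z.even d).
rewrite E {E}; congr pair; first by rewrite Z.add_assoc.
by case: (Z.even (Z.add a b)); case: (Z.even (Z.add c d)) => /=; lia.
Qed.

Lemma pmul1 (x : pos) : pmul x pone = x.
Proof. by case: x => a b; rewrite /pmul /=; congr pair; [|case: ifP => _]; lia. Qed.

Lemma pmulVr (g : pos) : pmul g (pinv g) = pone.
Proof.
case: g => a b; rewrite /pmul /pinv /pone /=; congr pair; first by lia.
by case: (Z.even _); lia.
Qed.

Lemma pmulK (g : pos) : cancel (pmul^~ g) (pmul^~ (pinv g)).
Proof. by move=> x /=; rewrite pmulA pmulVr pmul1. Qed.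

Lemma pmulI (x : pos) : injective (pmul x).
Proof.
case: x => a b [c d] [e f] [] /=.
by case: (Z.even _) => E1 E2; congr pair; lia.
Qed.

Definition toZ (u : int * int) : pos := (Z_of_int u.1, Z_of_int u.2).
Definition ofZ (x : pos) : int * int := (int_of_Z x.1, int_of_Z x.2).

Lemma toZK : cancel toZ ofZ.
Proof. by case=> a b; rewrite /toZ /ofZ /= !Z_of_intK. Qed.

Lemma ofZK : cancel ofZ toZ.
Proof. by case=> a b; rewrite /toZ /ofZ /= !int_of_ZK. Qed.

Definition dirs : seq pos :=
  [:: (Zpos xH, Z0); (Zneg xH, Z0); (Z0, Zpos xH)].

Lemma even_toZ (u : int * int) :
  Z.even (Z.add (toZ u).1 (toZ u).2) = (2 %| (u.1 + u.2)%R)%Z.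
Proof.
case: u => a b; rewrite /toZ /=.
apply/idP/idP.
  move=> /Zeven_bool_iff/Zeven_ex[k Hk]; apply/dvdzP; exists (int_of_Z k).
  by lia.
move=> /dvdzP[q Hq].
have -> : Z.add (Z_of_int a) (Z_of_int b) = Z.mul (Zpos (xO xH)) (Z_of_int q) by lia.
by rewrite Z.even_mul.
Qed.

(** Right multiplication by (0,1) goes up from an even vertex and down from an odd one, which is
    exactly the rule for vertical edges. *)
Lemma hex_gridE (u v : int * int) :
  hex_grid u v = (toZ v \in map (pmul (toZ u)) dirs).
Proof.
rewrite /hex_grid /hex_up -!even_toZ /= !inE /pmul /=.
case: u v => [a b] [c d]; rewrite /toZ /= !xpair_eqE.
(* A downward edge tests parity at its lower end [v], whereas the group law reads it at [u]; the two
   parities are opposite. *)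
have P : (a == c) && (b == d + 1)%R ->
    Z.even (Z.add (Z_of_int c) (Z_of_int d)) = ~~ Z.even (Z.add (Z_of_int a) (Z_of_int b)).
  move=> /andP[/eqP -> /eqP ->].
  have -> : Z_of_int (d + 1)%R = Z.add (Z_of_int d) (Zpos xH) by lia.
  by rewrite !evenD /=; case: (Z.even (Z_of_int c)); case: (Z.even _).
move: P; case: (Z.even (Z.add (Z_of_int a) _)); case: (Z.even _) => /=; lia.
Qed.

(** * Balls *)

(** A sphere asks for a shortest walk; the least length of a walk from [v] to [w] supplies its
    index. *)
Lemma ball_uptoP (V : choiceType) (e : rel V) (k : nat) (v w : V) :
  ball_upto e k v w <->
  exists p : seq V, [/\ path e v p, last v p = w & (size p <= k)%N].
Proof.
split=> [[i /= ik [[p [ep lp sp]] _]]|[p [ep lp sp]]].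
  by exists p; split=> //; rewrite sp.
have /ex_minnP[m /asboolP[q [eq lq sq]] mmin] :
    exists n, `[< exists q, [/\ path e v q, last v q = w & size q = n] >].
  by exists (size p); apply/asboolP; exists p.
exists m; first by rewrite /= ltnS (leq_trans _ sp) // mmin //; apply/asboolP; exists p.
split; first by exists q.
by move=> q' eq' lq'; apply: mmin; apply/asboolP; exists q'.
Qed.

Lemma ball_upto_step (V : choiceType) (e : rel V) (k : nat) (v w x : V) :
  ball_upto e k v w -> e w x -> ball_upto e k.+1 v x.
Proof.
move=> /ball_uptoP[p [ep lp sp]] wx; apply/ball_uptoP; exists (rcons p x).
by rewrite rcons_path ep lp wx last_rcons size_rcons ltnS.
Qed.

Lemma ball_upto_le (V : choiceType) (e : rel V) (k l : nat) (v w : V) :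
  (k <= l)%N -> ball_upto e k v w -> ball_upto e l v w.
Proof.
move=> kl /ball_uptoP[p [ep lp sp]]; apply/ball_uptoP; exists p.
by split=> //; apply: leq_trans kl.
Qed.

Definition box (k : nat) (v : int * int) : seq (int * int) :=
  [seq (v.1 + i%:Z - k%:Z, v.2 + j%:Z - k%:Z)%R | i <- iota 0 k.*2.+1, j <- iota 0 k.*2.+1].

Lemma mem_box (k : nat) (v w : int * int) :
  (w \in box k v) = (`|w.1 - v.1| <= k)%N && (`|w.2 - v.2| <= k)%N.
Proof.
have H (i j : nat) : (i < k.*2.+1)%N -> (j < k.*2.+1)%N ->
    w = (v.1 + i%:Z - k%:Z, v.2 + j%:Z - k%:Z)%R ->
    (`|w.1 - v.1| <= k)%N /\ (`|w.2 - v.2| <= k)%N.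
  by move=> hi hj -> /=; lia.
apply/allpairsP/andP => [[[i j] []]|[h1 h2]].
  by rewrite !mem_iota; exact: H.
exists (`|(w.1 - v.1 + Posz k)%R|%N, `|(w.2 - v.2 + Posz k)%R|%N).
rewrite !mem_iota /=; case: w v h1 h2 {H} => a b [c d] /= h1 h2.
by split; [lia|lia|congr pair; lia].
Qed.

Lemma hex_grid_dist (v x : int * int) : hex_grid v x ->
  (`|x.1 - v.1| <= 1)%N && (`|x.2 - v.2| <= 1)%N.
Proof.
case: v x => a b [c d]; rewrite /hex_grid /hex_up /=.
by case/or3P; [|case/and3P=> + + _|case/and3P=> + + _]; lia.
Qed.

Lemma hex_ball_box (k : nat) (v w : int * int) :
  ball_upto hex_grid k v w -> w \in box k v.
Proof.
move=> /ball_uptoP[p [ep <- sp]]; rewrite mem_box.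
have : (`|(last v p).1 - v.1| <= size p)%N && (`|(last v p).2 - v.2| <= size p)%N.
  elim: p v ep {sp} => [|x p IH] v /=; first by lia.
  case/andP=> /hex_grid_dist + /IH.
  by case: v x (last x p) => [a b] [c d] [m n] /=; lia.
by case/andP=> h1 h2; rewrite !(leq_trans _ sp).
Qed.

Lemma finite_hex_ball (k : nat) (v : int * int) :
  finite_set (ball_upto hex_grid k v).
Proof.
by apply: (@sub_finite_set _ _ [set` box k v]) => [w /hex_ball_box|]; last exact: finite_seq.
Qed.

Lemma card_hex_ball (k : nat) (v : int * int) :
  (#|` fset_set (ball_upto hex_grid k v)| <= k.*2.+1 ^ 2)%N.
Proof.
have -> : (k.*2.+1 ^ 2)%N = size (box k v) by rewrite size_allpairs size_iota mulnn.
apply: (@uniq_leq_size _ (fset_set (ball_upto hex_grid k v))); first exact: fset_uniq.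
move=> w; rewrite in_fset_set; last exact: finite_hex_ball.
by rewrite inE => /hex_ball_box.
Qed.

(** * Sums over finite sets and their translates *)

Lemma big_fsetD_nat (T : choiceType) (B B' : {fset T}) (f : T -> nat) :
  (B `<=` B')%fset ->
  (\sum_(x <- B') f x = \sum_(x <- B) f x + \sum_(x <- (B' `\` B)%fset) f x)%N.
Proof.
move=> /fsubsetP BB'; rewrite (big_fsetID _ (mem B)) /=; congr addn.
  congr (\sum_(i <- enum_fset _) _)%N; apply/fsetP => x.
  by rewrite !inE /=; apply/andP/idP => [[]//|xB]; rewrite BB'.
by congr (\sum_(i <- enum_fset _) _)%N; apply/fsetP => x; rewrite !inE /= andbC.
Qed.

(** The image of [B] under [g] lies in [B'], so its sum can exceed the sum over [B] only through
    points of [B'] outside [B], each worth at most [M]. This is the boundary term of the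
    discharging. *)
Lemma sum_shift (T : choiceType) (B B' : {fset T}) (g : T -> T) (f : T -> nat) (M : nat) :
  injective g -> {in B, forall x, g x \in B'} -> (B `<=` B')%fset ->
  (forall x, f x <= M)%N ->
  (\sum_(x <- B) f (g x) <= \sum_(x <- B) f x + M * (#|` B'| - #|` B|))%N.
Proof.
move=> gI gB BB' fM.
have -> : (\sum_(x <- B) f (g x) = \sum_(y <- [fset g x | x in B]%fset) f y)%N.
  by rewrite big_imfset //= => x y _ _; exact: gI.
have S : ([fset g x | x in B] `<=` B')%fset.
  by apply/fsubsetP => y /imfsetP[x /= xB ->]; exact: gB.
apply: (@leq_trans (\sum_(x <- B') f x)%N).
  by rewrite (big_fsetD_nat _ S) leq_addr.
rewrite (big_fsetD_nat _ BB') leq_add2l -cardfsDS //.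
rewrite (leq_trans (leq_sum _ (fun x _ => fM x))) //.
by rewrite big_const_seq count_predT iter_addn_0.
Qed.

(** * From a flux inequality on balls to the density *)

Section Growth.
Local Open Scope ring_scope.

Lemma le_exp_Bernoulli (R : realType) (x : R) (n : nat) :
  0 <= x -> 1 + n%:R * x <= (1 + x) ^+ n.
Proof.
move=> x0; elim: n => [|n IH]; first by rewrite mul0r addr0 expr0.
rewrite exprS -natr1.
have n0 : (0 : R) <= n%:R by [].
have h : (1 + x) * (1 + n%:R * x) <= (1 + x) * (1 + x) ^+ n.
  by rewrite ler_pM2l //; lra.
apply: le_trans h; nra.
Qed.

(** Along steps of length [r] the sequence dominates [(1 + x) ^ j]. Taking [j = 3m], the cube of
    Bernoulli's inequality gives a lower bound cubic in [m], against an upper bound quadratic in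
    [m]. *)
Lemma no_quadratic_geometric (R : realType) (b : nat -> nat) (N r : nat) (x : R) :
  0 < x -> (forall k, 0 < b k <= k.*2.+1 ^ 2)%N ->
  (forall k, (N <= k)%N -> (1 + x) * (b k)%:R <= (b (k + r)%N)%:R) -> False.
Proof.
move=> x0 hb hx.
have H j : (1 + x) ^+ j <= (b (N + j * r)%N)%:R.
  elim: j => [|j IH]; first by rewrite expr0 ler1n; case/andP: (hb (N + 0 * r)%N).
  have -> : (N + j.+1 * r = N + j * r + r)%N by rewrite mulSn; lia.
  apply: le_trans (hx _ (leq_addr _ _)).
  by rewrite exprS ler_pM2l //; lra.
(* For [m >= 1], [2 (N + 3 m r) + 1 <= K m]; the choice of [m] below then makes [(m x)^3] exceed
   [(K m)^2]. *)
pose K : R := (N.*2.+1 + 6 * r)%:R.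
have x3 : 0 < x ^+ 3 by rewrite exprn_gt0.
pose m := (Num.trunc (K ^+ 2 / x ^+ 3)).+1.
have mK : K ^+ 2 < m%:R * x ^+ 3.
  by rewrite -ltr_pdivrMr // truncnS_gt.
have m0 : (0 : R) < m%:R by rewrite ltr0n.
have lo : (m%:R * x) ^+ 3 <= (1 + x) ^+ (m * 3).
  rewrite exprM lerXn2r // ?nnegrE ?mulr_ge0 ?exprn_ge0 //; try lra.
  by apply: le_trans (le_exp_Bernoulli m (ltW x0)); lra.
have hi : ((b (N + m * 3 * r)%N)%:R : R) <= (K * m%:R) ^+ 2.
  rewrite /K -natrM -natrX ler_nat.
  case/andP: (hb (N + m * 3 * r)%N) => _ h; apply: leq_trans h _.
  by rewrite leq_sqr /m; nia.
have := le_trans (le_trans lo (H _)) hi.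
apply/negP; rewrite -ltNge exprMn.
have -> : (m%:R * x) ^+ 3 = m%:R * x ^+ 3 * m%:R ^+ 2 :> R by ring.
by rewrite ltr_pM2r ?exprn_gt0.
Qed.

End Growth.

Section Density.
Local Open Scope ring_scope.

(** If the limsup were below 5/12, some tail of the ratios would stay below a real [t < 5/12]. The
    hypothesis then bounds [(30 - 72 t) b k] by a multiple of [b (k + r) - b k], so [b] grows
    geometrically. *)
Lemma hex_code_density_ge (R : realType) (D : set (int * int)) (v : int * int) (C r : nat) :
  let b k := #|` fset_set (ball_upto hex_grid k v)| in
  let a k := #|` fset_set (ball_upto hex_grid k v `&` D)%classic| in
  (forall k, 30 * b k <= 72 * a k + C * (b (k + r) - b k))%N ->
  ((5%:R / 12%:R : R)%:E <= code_density hex_grid R D v)%E.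
Proof.
move=> b a hab; rewrite /code_density /limn_esup limf_esupE.
apply: le_ereal_inf_tmp => _ [V [N _ NV] <-].
rewrite leNgt; apply/negP => hlt.
have b0 k : (0 < b k)%N.
  rewrite cardfs_gt0; apply/fset0Pn; exists v.
  rewrite in_fset_set; last exact: finite_hex_ball.
  by rewrite inE; apply/ball_uptoP; exists [::].
have hb k : (0 < b k <= k.*2.+1 ^ 2)%N by rewrite b0 card_hex_ball.
(* Monotonicity turns the truncated subtraction of the hypothesis into a real one. *)
have mono k : (b k <= b (k + r)%N)%N.
  apply: fsubset_leq_card; apply/fsubsetP => w.
  rewrite !in_fset_set ?inE; [|exact: finite_hex_ball..].
  by apply: ball_upto_le; exact: leq_addr.
set s := ereal_sup _ in hlt.
have us k : (N <= k)%N -> (((a k)%:R / (b k)%:R : R)%:E <= s)%E.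
  by move=> Nk; apply: ereal_sup_ubound; exists k => //; apply: NV.
(* The tail supremum lies between one of its ratios and 5/12, hence is finite. *)
have [t st t5] : exists2 t : R, s = t%:E & t < 5%:R / 12%:R.
  move: hlt (us N (leqnn N)); case: s {us} => [t|//|//].
  by rewrite lte_fin => ht _; exists t.
(* The successor keeps the divisor positive when [C = 0]. *)
pose c : R := C.+1%:R.
have c0 : 0 < c by rewrite ltr0n.
apply: (@no_quadratic_geometric R b N r ((30 - 72 * t) / c)) => //.
  by rewrite divr_gt0 //; lra.
move=> k Nk; have := us k Nk; rewrite st lee_fin ler_pdivrMr ?ltr0n // => hak.
have h : 30 * (b k)%:R <= 72 * (a k)%:R + c * ((b (k + r)%N)%:R - (b k)%:R) :> R.
  rewrite /c -natrB // -!natrM -natrD ler_nat.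
  by apply: leq_trans (hab k) _; rewrite leq_add2l leq_mul2r leqnSn orbT.
rewrite mulrDl mul1r -lerBrDl mulrAC ler_pdivrMr //.
nra.
Qed.

End Density.

(** * Verified branch and bound over decision trees *)

Inductive dtree := Leaf of Z | Node of pos & dtree & dtree.

(* The [false] subtree comes first. *)
Fixpoint dval (rho : pos -> bool) (t : dtree) : Z :=
  match t with
  | Leaf w => w
  | Node p t0 t1 => if rho p then dval rho t1 else dval rho t0
  end.

Fixpoint dmap (f : pos -> pos) (t : dtree) : dtree :=
  match t with
  | Leaf w => Leaf w
  | Node p t0 t1 => Node (f p) (dmap f t0) (dmap f t1)
  end.

Lemma eq_dval (rho sigma : pos -> bool) t : rho =1 sigma -> dval rho t = dval sigma t.
Proof. by move=> E; elim: t => //= p t0 -> t1 ->; rewrite E. Qed.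

Lemma dval_map f rho t : dval rho (dmap f t) = dval (rho \o f) t.
Proof. by elim: t => //= p t0 -> t1 ->. Qed.

Fixpoint dbounded (M : Z) (t : dtree) : bool :=
  match t with
  | Leaf w => Z.leb Z0 w && Z.leb w M
  | Node _ t0 t1 => dbounded M t0 && dbounded M t1
  end.

Lemma dval_bounded M rho t : dbounded M t -> Z.le Z0 (dval rho t) /\ Z.le (dval rho t) M.
Proof.
elim: t => [w|p t0 IH0 t1 IH1] /= /andP[].
  by move=> /Z.leb_le h0 /Z.leb_le hM.
by case: (rho p) => b0 b1; [exact: IH1 | exact: IH0].
Qed.

Fixpoint dall (a : pos -> bool) (t : dtree) : bool :=
  match t with
  | Leaf w => true
  | Node p t0 t1 => [&& a p, dall a t0 & dall a t1]
  end.

Lemma sub_dall (a b : pos -> bool) t : (forall p, a p -> b p) -> dall a t -> dall b t.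
Proof. by move=> ab; elim: t => //= p t0 IH0 t1 IH1 /and3P[/ab -> /IH0 -> /IH1 ->]. Qed.

(** Decision trees for the search: each node caches a lower and an upper bound of its leaves, and
    variables are numbered for use in [PositiveMap]. *)
Inductive btree := BLeaf of Z | BNode of positive & Z & Z & btree & btree.

Definition blo (t : btree) : Z := match t with BLeaf w => w | BNode _ l _ _ _ => l end.
Definition bhi (t : btree) : Z := match t with BLeaf w => w | BNode _ _ h _ _ => h end.

(** Equal bounds mean a constant tree, which collapses to a leaf so that [settle] can absorb it into
    the accumulator. *)
Definition bnode (k : positive) (t0 t1 : btree) : btree :=
  let l := Z.min (blo t0) (blo t1) in
  let h := Z.max (bhi t0) (bhi t1) in
  if Z.eqb l h then BLeaf l else BNode k l h t0 t1.

Fixpoint bval (sigma : positive -> bool) (t : btree) : Z :=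
  match t with
  | BLeaf w => w
  | BNode k _ _ t0 t1 => if sigma k then bval sigma t1 else bval sigma t0
  end.

Fixpoint bwf (t : btree) : Prop :=
  match t with
  | BLeaf _ => True
  | BNode _ l h t0 t1 =>
    [/\ Z.le l (Z.min (blo t0) (blo t1)), Z.le (Z.max (bhi t0) (bhi t1)) h, bwf t0 & bwf t1]
  end.

Fixpoint brestrict (k : positive) (b : bool) (t : btree) : btree :=
  match t with
  | BLeaf _ => t
  | BNode k' _ _ t0 t1 =>
    if Pos.eqb k k' then (if b then t1 else t0)
    else bnode k' (brestrict k b t0) (brestrict k b t1)
  end.

Lemma bval_bounds sigma t : bwf t ->
  Z.le (blo t) (bval sigma t) /\ Z.le (bval sigma t) (bhi t).
Proof.
elim: t => [w|k l h t0 IH0 t1 IH1] /=; first by lia.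
by case=> hl hh /IH0 h0 /IH1 h1; case: (sigma k); lia.
Qed.

Lemma bnode_wf k t0 t1 : bwf t0 -> bwf t1 -> bwf (bnode k t0 t1).
Proof. by move=> w0 w1; rewrite /bnode; case: ifP => //= _; split=> //; lia. Qed.

Lemma bval_bnode sigma k t0 t1 : bwf t0 -> bwf t1 ->
  bval sigma (bnode k t0 t1) = if sigma k then bval sigma t1 else bval sigma t0.
Proof.
move=> /(bval_bounds sigma) h0 /(bval_bounds sigma) h1.
by rewrite /bnode; case: ifP => //= e; case: (sigma k); lia.
Qed.

Lemma brestrictP sigma k b t : bwf t -> sigma k = b ->
  bwf (brestrict k b t) /\ bval sigma (brestrict k b t) = bval sigma t.
Proof.
move=> + kb; elim: t => [//|k' l h t0 IH0 t1 IH1] /= [_ _ w0 w1].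
have [w0' v0] := IH0 w0; have [w1' v1] := IH1 w1.
case: Pos.eqb_spec => [<-|_]; first by rewrite kb; case: (b).
by split; [apply: bnode_wf | rewrite bval_bnode // v0 v1].
Qed.

(** * The search and its soundness *)

Definition settle (t : btree) (s : Z * seq btree) : Z * seq btree :=
  match t with
  | BLeaf w => (Z.add s.1 w, s.2)
  | _ => (s.1, t :: s.2)
  end.

Definition restrict_all k b (acc : Z) (ts : seq btree) : Z * seq btree :=
  foldr (fun t => settle (brestrict k b t)) (acc, [::]) ts.

(** The relaxation used for pruning: each tree is minimised separately, ignoring the variables they
    share. *)
Definition lower_bound (acc : Z) (ts : seq btree) : Z :=
  foldr (fun t => Z.add (blo t)) acc ts.

Definition total sigma (acc : Z) (ts : seq btree) : Z :=
  foldr (fun t => Z.add (bval sigma t)) acc ts.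

Definition all_wf (ts : seq btree) : Prop := foldr (fun t P => bwf t /\ P) True ts.

(** Branching heuristic: a variable scores the total spread [h - l] of the trees having it at the
    root. The second component keeps the best score so far. *)
Definition add_score (s : PositiveMap.t Z * (positive * Z)) (t : btree) :=
  match t with
  | BLeaf _ => s
  | BNode k l h _ _ =>
    let v := Z.add (Z.sub h l) (odflt Z0 (PositiveMap.find k s.1)) in
    (PositiveMap.add k v s.1, if Z.ltb s.2.2 v then (k, v) else s.2)
  end.

Definition branching_key (ts : seq btree) : positive :=
  (foldl add_score (PositiveMap.empty Z, (xH, Z0)) ts).2.1.

(** A clause lists variables of which at least one is true. It is stored under each of its
    variables, so setting one to false calls for a check of that bucket alone; as no literal is
    negative, only false variables are recorded. *)
Definition ctable := PositiveMap.t (seq (seq positive)).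

Definition bucket (tbl : ctable) (k : positive) : seq (seq positive) :=
  odflt [::] (PositiveMap.find k tbl).

Definition conflict (tbl : ctable) (falses : PositiveMap.t unit) (k : positive) : bool :=
  has (all (fun j => PositiveMap.mem j falses)) (bucket tbl k).

Fixpoint search (fuel : nat) (thr : Z) (tbl : ctable) (falses : PositiveMap.t unit)
    (acc : Z) (ts : seq btree) : bool :=
  if Z.leb thr (lower_bound acc ts) then true else
  if fuel is fuel'.+1 then
    let k := branching_key ts in
    let falses' := PositiveMap.add k tt falses in
    (if conflict tbl falses' k then true else
     let s := restrict_all k false acc ts in search fuel' thr tbl falses' s.1 s.2)
    && (let s := restrict_all k true acc ts in search fuel' thr tbl falses s.1 s.2)
  else false.

Definition table_ok (sigma : positive -> bool) (tbl : ctable) : Prop :=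
  forall k, all (has sigma) (bucket tbl k).

Lemma lower_boundP sigma acc ts : all_wf ts ->
  Z.le (lower_bound acc ts) (total sigma acc ts).
Proof.
by elim: ts => [|t ts IH] /=; [lia|case=> /(bval_bounds sigma) h /IH]; lia.
Qed.

Lemma settleP sigma t s : bwf t -> all_wf s.2 ->
  all_wf (settle t s).2 /\
  total sigma (settle t s).1 (settle t s).2 = Z.add (bval sigma t) (total sigma s.1 s.2).
Proof.
case: s => a l; case: t => [w|k lo hi t0 t1] //= _ wl; split=> //.
elim: l {wl} => [|u l /= IHl]; first exact: Z.add_comm.
by rewrite IHl !Z.add_assoc (Z.add_comm _ w).
Qed.

Lemma restrict_allP sigma k b acc ts : all_wf ts -> sigma k = b ->
  all_wf (restrict_all k b acc ts).2 /\
  total sigma (restrict_all k b acc ts).1 (restrict_all k b acc ts).2 = total sigma acc ts.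
Proof.
move=> + kb; elim: ts => [//|t ts IH] /= [wt /IH[w e]].
have [wt' vt'] := brestrictP wt kb.
by have [wl ->] := settleP sigma wt' w; split=> //; rewrite vt' e.
Qed.

Definition falses_ok (sigma : positive -> bool) (falses : PositiveMap.t unit) : Prop :=
  forall j, PositiveMap.mem j falses -> sigma j = false.

Lemma no_conflict sigma tbl falses k :
  table_ok sigma tbl -> falses_ok sigma falses -> ~~ conflict tbl falses k.
Proof.
move=> /(_ k) + fP; rewrite /conflict; elim: (bucket tbl k) => //= c cs IH /andP[hc /IH /negbTE ->].
rewrite orbF; elim: c hc => //= j c IHc.
have [/fP ->|//] := boolP (PositiveMap.mem j falses); exact: IHc.
Qed.

(** Only the branch agreeing with [sigma] matters: restriction preserves the total there, no clause
    is violated, and the branch ends at a node where the lower bound reaches [thr]. *)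
Lemma searchP fuel thr tbl falses acc ts sigma :
  table_ok sigma tbl -> falses_ok sigma falses -> all_wf ts ->
  search fuel thr tbl falses acc ts -> Z.le thr (total sigma acc ts).
Proof.
move=> tblP; elim: fuel falses acc ts => [|fuel IH] falses acc ts fP wf /=;
  (case: ifP => [/Z.leb_le h _|_]; first exact: (Z.le_trans _ _ _ h (lower_boundP wf))).
  by [].
set k := branching_key _; case/andP=> h0 h1.
case E : (sigma k).
  have [w e] := restrict_allP acc wf E.
  by rewrite -e; apply: IH h1.
have [w e] := restrict_allP acc wf E.
have fP' : falses_ok sigma (PositiveMap.add k tt falses).
  move=> j; rewrite PositiveMap.mem_find PositiveMapAdditionalFacts.gsspec.
  by case: PositiveMap.E.eq_dec => [->//|_]; rewrite -PositiveMap.mem_find => /fP.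
move: h0; rewrite (negbTE (no_conflict k tblP fP')) => h0.
by rewrite -e; apply: IH h0.
Qed.

Definition add_clause (c : seq positive) (tbl : ctable) : ctable :=
  foldr (fun k m => PositiveMap.add k (c :: bucket m k) m) tbl c.

Definition make_table (cs : seq (seq positive)) : ctable :=
  foldr add_clause (PositiveMap.empty _) cs.

Lemma make_tableP sigma cs : all (has sigma) cs -> table_ok sigma (make_table cs).
Proof.
elim: cs => [_ k|c cs IH /= /andP[hc /IH tP]].
  by rewrite /bucket /make_table /= PositiveMap.gempty.
(* The clause stays whole while the induction runs over the keys under which it is inserted. *)
rewrite /add_clause; move: {2}c => s; elim: s => [//|j s IHs] k /=.
rewrite /bucket PositiveMapAdditionalFacts.gsspec.
by case: PositiveMap.E.eq_dec => [_|_] /=; rewrite ?hc; exact: IHs.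
Qed.

(** * Translating code conditions and flows into input for the search *)

Fixpoint btree_of (enc : pos -> positive) (neg : bool) (t : dtree) : btree :=
  match t with
  | Leaf w => BLeaf (if neg then Z.opp w else w)
  | Node p t0 t1 => bnode (enc p) (btree_of enc neg t0) (btree_of enc neg t1)
  end.

Lemma btree_ofP (enc : pos -> positive) (dec : positive -> pos) rho neg t :
  dall (fun p => dec (enc p) == p) t ->
  bwf (btree_of enc neg t) /\
  bval (rho \o dec) (btree_of enc neg t) = (if neg then Z.opp (dval rho t) else dval rho t).
Proof.
elim: t => [w|p t0 IH0 t1 IH1] //= /and3P[/eqP dp /IH0[w0 v0] /IH1[w1 v1]].
split; first exact: bnode_wf.
by rewrite bval_bnode //= dp v0 v1; case: (rho p); case: neg {IH0 IH1 v0 v1 w0 w1}.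
Qed.

(** All points outside [support] collide on one key, since [index] then returns the size of the
    list; hence the membership tests in [clauses] and [certified]. *)
Definition enc (support : seq pos) (p : pos) : positive := Pos.of_succ_nat (index p support).

Definition dec (support : seq pos) (k : positive) : pos := nth pone support (Pos.to_nat k).-1.

Lemma encK support p : p \in support -> dec support (enc support p) = p.
Proof. by move=> ps; rewrite /dec /enc SuccNat2Pos.id_succ nth_index. Qed.

Definition nbhd : seq pos := pone :: dirs.

(** The symmetric difference of the closed neighbourhoods of the identity and of [g]; a code
    separates [x] from [xg] when it meets the translate of this set by [x]. *)
Definition separators (g : pos) : seq pos :=
  let ng := map (pmul g) nbhd in
  [seq p <- nbhd | p \notin ng] ++ [seq p <- ng | p \notin nbhd].

Definition flow := (pos * dtree)%type.

(* [(s, t)] is the flow in which every vertex [y] sends to [y * s^-1] the amount computed by [t]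
   from the code seen from [y]; thus [x] receives it from [x * s]. *)
Definition inflow (f : flow) : dtree := dmap (pmul f.1) f.2.

Definition clauses (gs region support : seq pos) : seq (seq pos) :=
  let shapes := nbhd :: [seq separators g | g <- gs] in
  [seq c <- flatten [seq [seq map (pmul x) c | c <- shapes] | x <- region] |
    all (fun p => p \in support) c].

(** The summands of the net charge of the identity: its own charge, minus each outflow, plus each
    inflow. *)
Definition terms (weight : Z) (support : seq pos) (fs : seq flow) : seq btree :=
  bnode (enc support pone) (BLeaf Z0) (BLeaf weight) ::
  flatten [seq [:: btree_of (enc support) true f.2; btree_of (enc support) false (inflow f)]
          | f <- fs].

Definition certified (fuel : nat) (weight thr : Z) (gs region support : seq pos)
    (fs : seq flow) : bool :=
  [&& pone \notin gs, pone \in support,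
      all (fun f => dall (fun p => p \in support) f.2 &&
                    dall (fun p => p \in support) (inflow f)) fs &
      search fuel thr (make_table (map (map (enc support)) (clauses gs region support)))
        (PositiveMap.empty _) Z0 (terms weight support fs)].

Definition dominating (rho : pos -> bool) : Prop :=
  forall x, has (fun g => rho (pmul x g)) nbhd.

Definition separating (rho : pos -> bool) : Prop :=
  forall x g, g != pone -> has (fun h => rho (pmul x h)) (separators g).

Definition zsum (T : Type) (F : T -> Z) (s : seq T) : Z := foldr (fun x => Z.add (F x)) Z0 s.

Lemma clausesP rho gs region support : dominating rho -> separating rho -> pone \notin gs ->
  all (fun c => has rho c && all (fun p => p \in support) c) (clauses gs region support).
Proof.
move=> dr sr g1; apply/allP => c; rewrite mem_filter => /andP[-> ].
rewrite andbT => /flatten_mapP[x _] /mapP[c' c'in ->].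
rewrite has_map; move: c'in; rewrite inE => /orP[/eqP ->|/mapP[g ggs ->]].
  exact: dr.
by apply: sr; apply: contraNneq g1 => <-.
Qed.

(** Soundness of the search is applied to [rho] read through [dec]; every clause holds there because
    [rho] is dominating and separating. *)
Lemma certifiedP fuel weight thr gs region support fs rho :
  certified fuel weight thr gs region support fs -> dominating rho -> separating rho ->
  Z.le (Z.add thr (zsum (fun f => dval rho f.2) fs))
       (Z.add (if rho pone then weight else Z0)
              (zsum (fun f => dval (rho \o pmul f.1) f.2) fs)).
Proof.
case/and4P=> g1 s1 encT srch dr sr.
set sigma := rho \o dec support.
have tblP : table_ok sigma
    (make_table (map (map (enc support)) (clauses gs region support))).
  apply: make_tableP; rewrite all_map; apply/allP => c cin /=.
  have /andP[/hasP[p pc rp] /allP cs] := allP (clausesP region support dr sr g1) _ cin.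
  rewrite has_map; apply/hasP; exists p => //.
  have e : dec support (enc support p) = p by apply: encK; apply: cs.
  by change (is_true (rho (dec support (enc support p)))); rewrite e.
have conv neg t : dall (fun p => p \in support) t ->
    bwf (btree_of (enc support) neg t) /\
    bval sigma (btree_of (enc support) neg t) = (if neg then Z.opp (dval rho t) else dval rho t).
  by move=> ts; apply: btree_ofP; apply: sub_dall ts => p /encK ->; exact: eqxx.
have [wf tot] : all_wf (terms weight support fs) /\
    total sigma Z0 (terms weight support fs) =
    Z.add (if rho pone then weight else Z0)
      (Z.sub (zsum (fun f => dval (rho \o pmul f.1) f.2) fs) (zsum (fun f => dval rho f.2) fs)).
  have : all_wf (behead (terms weight support fs)) /\
    total sigma Z0 (behead (terms weight support fs)) =
      Z.sub (zsum (fun f => dval (rho \o pmul f.1) f.2) fs) (zsum (fun f => dval rho f.2) fs).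
    rewrite /=; elim: fs encT {srch} => [//|f fs IH] /= /andP[/andP[e1 e2] /IH[w t]].
    have [w1 v1] := conv true _ e1; have [w2 v2] := conv false _ e2.
    by split=> //; rewrite t v1 v2 dval_map; lia.
  case=> w t; split; first by split=> //; apply: bnode_wf.
  rewrite /= -[X in Z.add _ X]/(total _ _ (behead (terms weight support fs))) t bval_bnode //.
  have -> : sigma (enc support pone) = rho pone by exact: congr1 (encK s1).
  by [].
have f0 : falses_ok sigma (PositiveMap.empty _).
  by move=> j; rewrite PositiveMap.mem_find PositiveMap.gempty.
by have := searchP tblP f0 wf srch; rewrite tot; lia.
Qed.

(** * Local flows bound the density *)

Lemma closed_neighborhoodP (v w : int * int) :
  closed_neighborhood hex_grid v w <-> toZ w \in map (pmul (toZ v)) nbhd.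
Proof.
rewrite /nbhd map_cons in_cons pmul1 -hex_gridE; split.
  case=> [[[p [ep <- sp]] _]|->]; last by rewrite eqxx.
  by case: p ep sp => [|x [|y p]] //= /andP[-> _] _; rewrite orbT.
case/orP=> [/eqP /(can_inj toZK) ->|vw]; first by right.
have [->|nwv] := eqVneq w v; first by right.
left; split; first by exists [:: w]; rewrite /= vw.
by case=> //= _ vw'; rewrite vw' eqxx in nwv.
Qed.

Lemma code_dominating (D : set (int * int)) :
  identifying_code hex_grid D -> dominating (fun p => `[< D (ofZ p) >]).
Proof.
case=> dom _ x; have [w [/closed_neighborhoodP + Dw]] := dom (ofZ x).
rewrite ofZK => /mapP[g gN xg]; apply/hasP; exists g => //.
by rewrite -xg toZK; apply/asboolP.
Qed.

(** If the translated symmetric difference missed [D], every code vertex in one closed neighbourhood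
    would lie in the other, and the two traces would coincide. *)
Lemma code_separating (D : set (int * int)) :
  identifying_code hex_grid D -> separating (fun p => `[< D (ofZ p) >]).
Proof.
case=> _ sep x g g1; apply/negPn/negP => /hasPn nsep.
apply: (sep (ofZ x) (ofZ (pmul x g))).
  move=> /(can_inj ofZK); rewrite -{1}(pmul1 x) => /pmulI e.
  by rewrite -e eqxx in g1.
apply/seteqP; split=> w [/closed_neighborhoodP + Dw]; rewrite ofZK => /mapP[h hN wE];
  split=> //; apply/closed_neighborhoodP; rewrite ofZK.
  have [/mapP[h' h'N hE]|hn] := boolP (h \in map (pmul g) nbhd).
    by apply/mapP; exists h' => //; rewrite wE hE pmulA.
  have := nsep h; rewrite mem_cat mem_filter hn hN -wE toZK => /(_ isT).
  by move/asboolPn.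
have [gN|gn] := boolP (pmul g h \in nbhd).
  by apply/mapP; exists (pmul g h) => //; rewrite wE pmulA.
have := nsep (pmul g h); rewrite mem_cat !mem_filter gn map_f // orbT => /(_ isT).
by rewrite -pmulA -wE toZK => /asboolPn.
Qed.

(** * Summing the local inequality over a ball *)

Fixpoint walks (n : nat) : seq pos :=
  if n is m.+1 then walks m ++ [seq pmul x d | x <- walks m, d <- dirs] else [:: pone].

(** A right translation: not a grid automorphism in general, but a bijection that moves every vertex
    along the same word [s], hence by a bounded distance. *)
Definition shift (s : pos) (u : int * int) : int * int := ofZ (pmul (toZ u) s).

Lemma shift_inj s : injective (shift s).
Proof. by move=> u w /(can_inj ofZK) /(can_inj (pmulK s)) /(can_inj toZK). Qed.

Lemma ball_shift n s k v u : s \in walks n ->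
  ball_upto hex_grid k v u -> ball_upto hex_grid (k + n) v (shift s u).
Proof.
elim: n s => [|n IH] s.
  by rewrite inE => /eqP ->; rewrite /shift pmul1 toZK addn0.
rewrite -[walks _]/(_ ++ allpairs _ _ _) mem_cat => /orP[sn|/allpairsP[[x d] [xn dd ->]]] uB.
  by apply: (@ball_upto_le _ _ (k + n)); [rewrite addnS | exact: IH].
rewrite addnS; apply: (ball_upto_step (IH _ xn uB)).
by rewrite hex_gridE /shift !ofZK -pmulA map_f.
Qed.

Definition dval_at (D : set (int * int)) (u : int * int) (t : dtree) : nat :=
  Z.to_nat (dval (fun g => `[< D (shift g u) >]) t).

Lemma zsum_to_nat (T : Type) (F : T -> Z) (s : seq T) :
  all (fun x => Z.leb Z0 (F x)) s ->
  zsum F s = Z.of_nat (\sum_(x <- s) Z.to_nat (F x))%N.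
Proof.
elim: s => [|x s IH] /=; first by rewrite big_nil.
by case/andP=> /Z.leb_le x0 /IH ->; rewrite big_cons; lia.
Qed.

(** Left translations preserve domination and separation, so the certificate applies to [D] seen
    from [u]. By associativity the inflow along [s] at [u] is the outflow computed at [us]. *)
Lemma local_inequality D fuel scale gs region support fs M (u : int * int) :
  identifying_code hex_grid D ->
  certified fuel (Z.mul (Zpos 72) (Zpos scale)) (Z.mul (Zpos 30) (Zpos scale))
    gs region support fs ->
  all (fun f => dbounded M f.2) fs ->
  (30 * Pos.to_nat scale + \sum_(f <- fs) dval_at D u f.2 <=
   72 * Pos.to_nat scale * `[< D u >] + \sum_(f <- fs) dval_at D (shift f.1 u) f.2)%N.
Proof.
move=> Dcode cert bnd.
pose rho x g := `[< D (ofZ (pmul x g)) >].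
have dr : dominating (rho (toZ u)).
  move=> x; have := code_dominating Dcode (pmul (toZ u) x).
  by under eq_has do rewrite pmulA.
have sr : separating (rho (toZ u)).
  move=> x g g1; have := code_separating Dcode (pmul (toZ u) x) g1.
  by under eq_has do rewrite pmulA.
have := certifiedP cert dr sr.
have nonneg (sigma : flow -> pos -> bool) : all (fun f => Z.leb Z0 (dval (sigma f) f.2)) fs.
  apply: sub_all bnd => f /(dval_bounded (sigma f))[h _]; exact/Z.leb_le.
rewrite (zsum_to_nat (nonneg (fun=> rho (toZ u)))).
rewrite (zsum_to_nat (nonneg (fun f => rho (toZ u) \o pmul f.1))).
have -> : (\sum_(f <- fs) Z.to_nat (dval (rho (toZ u) \o pmul f.1) f.2) =
    \sum_(f <- fs) dval_at D (shift f.1 u) f.2)%N.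
  apply: eq_bigr => f _; congr Z.to_nat; apply: eq_dval => g.
  by rewrite /rho /shift /= ofZK pmulA.
have -> : rho (toZ u) pone = `[< D u >] by rewrite /rho pmul1 toZK.
rewrite -[(\sum_(f <- fs) Z.to_nat (dval (rho (toZ u)) f.2))%N]/(\sum_(f <- fs) dval_at D u f.2)%N.
by case: `[< D u >]; lia.
Qed.

(** Conservation of charge: for each flow, inflow is outflow evaluated at an injectively shifted
    vertex, so [sum_shift] leaves a gain of at most [M] per vertex of the boundary layer. *)
Lemma sum_flows (D : set (int * int)) (fs : seq flow) M n k v :
  let B k := fset_set (ball_upto hex_grid k v) in
  all (fun f => dbounded M f.2) fs -> all (fun f => f.1 \in walks n) fs ->
  (\sum_(u <- B k) \sum_(f <- fs) dval_at D (shift f.1 u) f.2 <=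
   \sum_(u <- B k) \sum_(f <- fs) dval_at D u f.2 +
   Z.to_nat M * size fs * (#|` B (k + n)| - #|` B k|))%N.
Proof.
move=> B; rewrite ![(\sum_(u <- B k) \sum_(f <- fs) _)%N]exchange_big /=.
elim: fs => [|f fs IH]; first by rewrite !big_nil.
rewrite /= !big_cons => /andP[bf /IH{}IH] /andP[sf /IH{}IH].
have h : (\sum_(u <- B k) dval_at D (shift f.1 u) f.2 <=
  \sum_(u <- B k) dval_at D u f.2 + Z.to_nat M * (#|` B (k + n)| - #|` B k|))%N.
  apply: (@sum_shift _ (B k) (B (k + n)) _ (fun u => dval_at D u f.2)).
  - exact: shift_inj.
  - move=> u; rewrite !in_fset_set ?inE; [|exact: finite_hex_ball..].
    exact: ball_shift.
  - apply/fsubsetP => u; rewrite !in_fset_set ?inE; [|exact: finite_hex_ball..].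
    by apply: ball_upto_le; exact: leq_addr.
  - by move=> u; have [] := dval_bounded (fun g => `[< D (shift g u) >]) bf; rewrite /dval_at; lia.
by rewrite mulnS mulnDl; apply: leq_trans (leq_add h IH) _; rewrite addnACA.
Qed.

Lemma certificate_density (R : realType) fuel scale gs region support fs M n D v :
  certified fuel (Z.mul (Zpos 72) (Zpos scale)) (Z.mul (Zpos 30) (Zpos scale))
    gs region support fs ->
  all (fun f => dbounded M f.2) fs -> all (fun f => f.1 \in walks n) fs ->
  identifying_code hex_grid D ->
  ((5%:R / 12%:R : R)%R%:E <= code_density hex_grid R D v)%E.
Proof.
move=> cert bnd wlk Dcode.
apply: (@hex_code_density_ge R D v (Z.to_nat M * size fs) n) => k.
set B := fun k => fset_set (ball_upto hex_grid k v).
have -> : (#|` fset_set (ball_upto hex_grid k v `&` D)%classic| =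
    \sum_(u <- B k) `[< D u >])%N.
  have -> : (\sum_(u <- B k) `[< D u >] = count (fun u => `[< D u >]) (B k))%N.
    by rewrite -sum1_count [RHS]big_mkcond; apply: eq_bigr => u _; case: `[< D u >].
  rewrite -size_filter; apply: perm_size; apply: uniq_perm.
  - exact: fset_uniq.
  - by rewrite filter_uniq // fset_uniq.
  move=> u; rewrite mem_filter !in_fset_set; [|exact: finite_hex_ball|].
    by rewrite in_setI andbC.
  by apply: sub_finite_set (finite_hex_ball k v) => w [].
set S := Pos.to_nat scale; have := sum_flows D k v bnd wlk; rewrite -/(B k) -/(B (k + n)).
have : (\sum_(u <- B k) (30 * S + \sum_(f <- fs) dval_at D u f.2) <=
   \sum_(u <- B k) (72 * S * `[< D u >] +
     \sum_(f <- fs) dval_at D (shift f.1 u) f.2))%N.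
  by apply: leq_sum => u _; exact: (local_inequality _ Dcode cert bnd).
have -> F : (\sum_(u <- B k) (30 * S + F u) = 30 * S * #|` B k| + \sum_(u <- B k) F u)%N.
  by rewrite big_split big_const_seq count_predT iter_addn_0.
have -> F : (\sum_(u <- B k) (72 * S * `[< D u >] + F u) =
    72 * S * \sum_(u <- B k) `[< D u >] + \sum_(u <- B k) F u)%N.
  by rewrite big_split big_distrr.
have S0 : (0 < S)%N by have := Pos2Nat.is_pos scale; lia.
move: (\sum_(u <- B k) `[< D u >])%N (#|` B k|) => a b.
move: (\sum_(u <- B k) \sum_(f <- fs) dval_at D u f.2)%N => X.
move: (\sum_(u <- B k) \sum_(f <- fs) dval_at D (shift f.1 u) f.2)%N => Y hX hY.
set E := (Z.to_nat M * size fs * _)%N in hY *.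
have h : (S * (30 * b) <= S * (72 * a) + E)%N by lia.
(* The boundary term is enlarged by the factor [S], so that [S] cancels throughout. *)
rewrite -(leq_pmul2l S0); apply: leq_trans h _.
by rewrite mulnDr leq_add2l leq_pmull.
Qed.

(** * The certificate *)

Section Certificate.
Local Open Scope Z_scope.

(* In these coordinates the grid consists of the points of Z^3 with coordinate sum 0 or 1, two
   of them being adjacent when they differ in one coordinate. *)
Definition cubic (p : pos) : Z * Z * Z :=
  let: (i, j) := p in
  let k := (if Z.even (i + j) then i - j else i - 1 - j) / 2 in
  (if Z.even (i + j) then k else k + 1, - j - k, j).

Definition uncubic (t : Z * Z * Z) : pos :=
  let: (a, b, c) := t in (if a + b + c =? 0 then 2 * a + c else 2 * a + c - 1, c).

(* The six symmetries fixing the identity; nothing depends on their being automorphisms, the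
   branch and bound being run on all the flows they produce. *)
Definition symmetries : seq (pos -> pos) :=
  [seq (fun p => let: (a, b, c) := cubic p in uncubic (s a b c)) |
     s <- [:: (fun a b c => (a, b, c)); (fun a b c => (a, c, b)); (fun a b c => (b, a, c));
              (fun a b c => (b, c, a)); (fun a b c => (c, a, b)); (fun a b c => (c, b, a))]].

(** A flow is labelled by the inverse of the step it makes, so sending towards [s target] is
    recorded with [pinv]. *)
Definition symmetric_flows (target : pos) (t : dtree) : seq flow :=
  [seq (pinv (s target), dmap s t) | s <- symmetries].

Definition lf (w : Z) : dtree := Leaf w.
Definition nd (a b : Z) : dtree -> dtree -> dtree := Node (a, b).

(* The weights of the two trees below are the optimal solution of a linear program, in units of
   1/2000 and shifted to be nonnegative, which does not affect the net flow. *)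
Definition adjacent_flow : dtree :=
  nd 0 0 (nd 1 0 (nd (-1) 0 (nd 2 (-1) (nd 0 (-1) (nd 3 1 (nd 4 0 (lf 13241) (lf 13142))
  (lf 13729)) (nd (-2) 0 (nd (-1) 1 (lf 15437) (lf 14167)) (lf 16180))) (nd 3 1 (lf 13061)
  (lf 13502))) (nd 0 (-2) (nd (-1) (-1) (nd 3 0 (nd 3 (-1) (nd 0 (-1) (lf 7873) (lf 7195))
  (lf 6552)) (nd 3 (-1) (nd 2 1 (lf 5942) (nd (-3) 0 (lf 7039) (lf 7253))) (lf 5892))) (nd (-2) 1
  (nd 1 2 (nd 2 1 (lf 7924) (lf 8738)) (nd 1 1 (nd (-3) 1 (lf 9403) (nd (-2) 0 (lf 8733)
  (lf 9171))) (lf 7606))) (nd (-1) 1 (lf 8794) (lf 8526)))) (nd (-2) 0 (nd 2 (-1) (lf 7422)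
  (nd (-1) 1 (nd 3 1 (lf 6453) (lf 7026)) (lf 7826))) (nd 0 1 (nd (-3) 0 (nd (-1) 1 (lf 6489)
  (lf 7805)) (lf 7170)) (nd (-2) (-1) (nd (-2) 1 (lf 7866) (lf 7513)) (lf 8898)))))) (nd (-1) 0
  (nd 0 1 (nd 0 (-1) (nd (-1) 1 (lf 853) (nd 3 0 (lf 867) (lf 0))) (nd (-2) 0 (lf 578) (nd 2 (-1)
  (nd (-1) 2 (lf 1211) (lf 1335)) (lf 356)))) (nd 2 0 (nd (-2) (-1) (nd 2 (-1) (nd 1 1 (nd 4 0
  (lf 5418) (nd 4 (-1) (nd 2 1 (lf 4082) (nd (-2) 1 (lf 4142) (lf 4150))) (lf 6166))) (lf 3965))
  (nd (-1) 1 (nd (-3) 0 (nd (-2) 1 (nd 4 0 (nd 2 1 (lf 6030) (nd 2 (-2) (lf 6415) (lf 6836)))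
  (nd 2 1 (lf 6284) (nd 2 (-2) (lf 6398) (lf 6515)))) (nd 3 (-1) (lf 4766) (lf 4822))) (nd 4 0
  (nd 2 1 (nd 2 (-2) (nd 1 1 (lf 4009) (lf 3078)) (lf 4121)) (nd (-2) 1 (lf 3374) (lf 3139)))
  (nd 1 1 (nd 2 (-2) (nd 3 (-1) (lf 3436) (lf 3736)) (lf 3555)) (lf 3667)))) (nd (-2) 1 (lf 4057)
  (lf 3892)))) (nd (-3) 0 (nd (-1) 1 (nd 0 (-2) (nd 1 1 (nd (-1) (-1) (lf 4431) (lf 4370))
  (lf 4553)) (nd 4 0 (lf 4672) (lf 4612))) (lf 4131)) (nd 3 0 (nd 4 0 (nd 1 1 (nd (-2) 0 (lf 3362)
  (lf 3595)) (lf 3705)) (nd 4 (-1) (nd (-2) 0 (nd (-2) 1 (lf 4092) (lf 4045)) (nd 2 (-1) (lf 5865)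
  (lf 4793))) (nd 2 (-2) (nd 1 1 (nd 2 (-1) (lf 5260) (lf 4902)) (lf 3869)) (lf 3554)))) (nd 2 1
  (lf 4130) (lf 3674))))) (nd 2 1 (nd (-2) 0 (lf 4316) (nd (-3) 0 (lf 3704) (lf 3952))) (nd 4 0
  (lf 2840) (lf 1783))))) (nd 0 1 (nd 1 (-1) (nd 1 2 (nd 3 0 (nd (-1) (-1) (nd 4 (-1) (nd 0 (-1)
  (lf 4082) (nd (-2) 1 (lf 4142) (lf 4150))) (lf 3042)) (lf 3965)) (nd (-2) 0 (nd (-1) 2
  (nd (-2) 1 (nd 2 (-2) (nd 0 (-1) (lf 6030) (nd 4 0 (lf 6415) (lf 6836))) (nd 0 (-1) (lf 6282)
  (nd 4 0 (lf 6397) (lf 6515)))) (nd 2 (-2) (lf 4727) (lf 4863))) (nd 2 (-2) (nd 0 (-1) (nd 4 0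
  (nd (-1) (-1) (lf 4008) (lf 3078)) (lf 4121)) (nd (-2) 1 (lf 3373) (lf 3139))) (nd (-1) (-1)
  (nd 4 0 (nd 3 (-1) (lf 3438) (lf 3736)) (lf 3555)) (lf 3667)))) (nd (-2) 1 (lf 4057)
  (lf 3892)))) (nd (-1) 2 (nd (-2) 0 (nd 3 1 (nd (-1) (-1) (nd 1 1 (lf 4431) (lf 4373)) (lf 4553))
  (nd 2 (-2) (lf 4675) (lf 4610))) (lf 4131)) (nd 2 (-1) (nd 2 (-2) (nd (-1) (-1) (nd (-1) 1
  (lf 3362) (lf 3595)) (lf 3705)) (nd 4 (-1) (nd (-1) 1 (nd (-2) 1 (lf 4092) (lf 4039)) (nd 3 0
  (lf 5864) (lf 4793))) (nd 4 0 (nd (-1) (-1) (nd 3 0 (lf 5260) (lf 4902)) (lf 3869)) (lf 3554))))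
  (nd 0 (-1) (lf 4130) (lf 3674))))) (nd (-1) 1 (lf 2292) (nd (-1) 2 (nd 3 0 (lf 2788) (lf 1890))
  (lf 1920)))) (nd 0 (-1) (lf 3428) (lf 2721))))) (nd 1 0 (nd 1 (-1) (nd 2 0 (nd 0 (-1) (nd 3 1
  (lf 18062) (nd (-1) 0 (lf 18127) (nd 4 0 (lf 18688) (lf 18292)))) (nd 2 1 (lf 17308) (nd (-3) 0
  (lf 17296) (lf 17267)))) (nd 0 1 (nd 0 (-2) (nd (-2) 0 (nd 2 1 (nd (-3) 1 (nd 1 1 (lf 14532)
  (nd 3 (-1) (lf 14472) (lf 14464))) (lf 15572)) (lf 14649)) (nd 3 0 (nd 2 (-2) (nd 3 (-1)
  (nd (-1) 2 (nd (-1) 1 (nd (-3) 0 (lf 11894) (lf 12256)) (lf 12418)) (nd (-1) 1 (nd (-3) 1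
  (lf 12067) (lf 11958)) (lf 12613))) (nd (-2) 1 (lf 13847) (lf 13792))) (nd (-1) 2 (nd (-1) 1
  (nd 3 (-1) (lf 15216) (lf 15035)) (nd (-3) 0 (nd 2 1 (lf 15171) (lf 14444)) (lf 15494)))
  (nd (-1) 1 (nd (-3) 0 (nd (-2) 1 (lf 14989) (lf 15044)) (lf 15174)) (lf 14860)))) (nd 3 (-1)
  (lf 14557) (lf 14722)))) (nd 2 (-2) (nd 3 0 (nd (-2) (-1) (nd 2 1 (nd 0 (-1) (lf 14183)
  (lf 14244)) (lf 14060)) (nd (-1) 2 (lf 13942) (lf 14002))) (lf 14483)) (nd (-1) 1 (nd (-1) 2
  (nd 2 1 (nd 2 (-1) (lf 15252) (lf 15020)) (lf 14909)) (nd (-3) 1 (nd 2 (-1) (nd 3 (-1)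
  (lf 14522) (lf 14575)) (lf 16228)) (nd (-3) 0 (nd 2 1 (lf 16540) (lf 14745)) (lf 15060))))
  (nd 1 1 (lf 14484) (lf 14940))))) (nd 2 (-1) (lf 16322) (nd 2 (-2) (nd (-2) 0 (lf 15826)
  (lf 16724)) (lf 16694))))) (nd 2 0 (nd (-1) 0 (nd 3 1 (nd (-1) 1 (nd 0 (-1) (nd (-1) (-1)
  (lf 14698) (nd 3 (-1) (lf 17418) (lf 15799))) (lf 14649)) (nd 2 (-1) (nd 4 0 (nd 3 (-1)
  (lf 19697) (nd (-3) 0 (lf 13887) (lf 13751))) (nd (-3) 0 (nd (-2) 0 (nd 3 (-1) (lf 15216)
  (lf 15035)) (nd (-1) 2 (nd 0 (-1) (lf 15171) (lf 14443)) (lf 15494))) (nd (-2) 0 (nd (-1) 2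
  (nd (-2) 1 (lf 14989) (lf 15044)) (lf 15174)) (lf 14860)))) (nd 3 (-1) (lf 14557) (lf 14722))))
  (nd 4 0 (nd 0 (-1) (nd (-2) 1 (nd 3 0 (lf 14259) (lf 13965)) (nd (-1) (-1) (lf 14445) (nd 2 1
  (lf 13745) (lf 14955)))) (lf 13468)) (nd (-2) 0 (nd (-3) 0 (nd 0 (-1) (nd 3 0 (lf 15252)
  (lf 15019)) (lf 14909)) (nd (-3) 1 (nd 3 0 (nd 3 (-1) (lf 14522) (lf 14575)) (lf 16228))
  (nd (-1) 2 (nd 0 (-1) (lf 16540) (lf 14745)) (lf 15060)))) (nd (-1) (-1) (lf 14484)
  (lf 14940))))) (nd 3 0 (lf 16322) (nd 4 0 (nd (-1) 1 (lf 15827) (lf 16724)) (lf 16694))))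
  (nd (-1) (-1) (lf 15186) (lf 15893)))) (nd (-1) 0 (nd 2 (-2) (nd 0 1 (nd 1 1 (nd 4 0 (lf 4837)
  (lf 5003)) (nd (-1) (-1) (lf 5128) (lf 9307))) (nd 0 (-2) (lf 4422) (nd 2 (-1) (lf 5551)
  (lf 5752)))) (nd 0 (-2) (nd 0 1 (nd 2 1 (nd 2 0 (nd 3 (-1) (lf 5881) (lf 5874)) (lf 6242))
  (lf 5544)) (lf 5720)) (nd (-2) 0 (nd (-3) 0 (lf 5899) (nd 0 1 (nd 4 0 (lf 5475) (lf 5752))
  (lf 5641))) (nd (-1) (-1) (lf 6311) (lf 6998))))) (nd 1 2 (nd 2 (-1) (lf 15082) (lf 14504))
  (nd 3 0 (nd (-3) 0 (nd 2 1 (lf 16353) (lf 16134)) (nd (-2) 1 (lf 16301) (lf 16241))) (nd 2 1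
  (lf 16951) (lf 16609)))))).

Definition second_neighbour_flow : dtree :=
  nd 0 0 (nd 1 1 (nd (-2) 1 (nd 2 1 (nd 2 0 (nd (-3) 1 (lf 11582) (nd 2 2 (nd (-1) (-1) (lf 12330)
  (nd 1 (-1) (nd 0 2 (nd (-2) 2 (lf 11299) (lf 12537)) (lf 11219)) (lf 12362))) (lf 11600)))
  (nd (-1) 1 (nd (-2) 0 (nd 1 0 (nd (-1) (-1) (nd 4 0 (lf 9955) (nd 2 2 (lf 10012) (lf 9970)))
  (lf 10379)) (lf 10266)) (nd (-1) 0 (nd 2 2 (lf 8799) (lf 8173)) (lf 11238))) (nd 1 2 (nd 3 0
  (lf 10980) (lf 13649)) (lf 10358)))) (nd 0 1 (nd 3 1 (nd 3 0 (lf 10680) (lf 11435)) (lf 10405))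
  (nd (-1) (-1) (nd 1 0 (nd 3 (-1) (lf 9276) (lf 8850)) (nd 2 2 (lf 11503) (lf 8802))) (nd 1 0
  (lf 8692) (nd (-3) 0 (nd 4 0 (nd 2 2 (lf 7131) (nd 0 3 (nd 0 2 (lf 7451) (lf 5657)) (lf 4067)))
  (nd 2 2 (nd 3 (-1) (nd (-2) 2 (lf 7046) (lf 6617)) (lf 8561)) (nd 3 (-1) (nd 0 2 (nd 0 3
  (lf 7348) (lf 4388)) (nd 0 3 (lf 5677) (lf 3500))) (nd 0 2 (lf 7693) (lf 6082))))) (nd 3 (-1)
  (lf 7181) (nd (-2) 0 (lf 9357) (nd 4 0 (lf 7290) (lf 7421))))))))) (nd 3 1 (nd 2 0 (nd (-1) 0
  (nd 2 2 (nd (-1) (-1) (lf 8617) (lf 8639)) (nd 0 3 (nd 3 (-1) (nd (-1) (-1) (lf 9158) (nd (-3) 0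
  (nd (-2) 0 (lf 8696) (lf 9933)) (lf 9065))) (nd (-1) (-1) (nd 4 0 (nd (-3) 1 (lf 9438)
  (lf 8892)) (lf 7518)) (nd 4 0 (nd (-2) 0 (nd (-3) 0 (lf 8958) (lf 9743)) (nd (-3) 0 (lf 11813)
  (lf 10642))) (nd (-2) 0 (lf 8118) (lf 8662))))) (nd 4 0 (lf 8681) (nd 0 2 (lf 9169)
  (lf 8425))))) (nd (-2) 2 (nd 4 0 (nd 0 1 (lf 10628) (lf 9195)) (lf 10265)) (nd (-1) (-1) (nd 2 2
  (lf 10572) (nd (-2) 0 (nd (-3) 1 (lf 9637) (lf 10385)) (lf 10927))) (lf 10780)))) (nd 2 2
  (nd 0 2 (nd (-1) 2 (nd 2 1 (lf 13264) (lf 10046)) (lf 11499)) (lf 9658)) (nd 2 1 (nd 0 2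
  (nd (-1) 0 (lf 11476) (nd 0 1 (lf 11324) (lf 13772))) (lf 10519)) (nd 0 3 (lf 10225)
  (lf 9852))))) (nd 2 1 (nd (-1) 1 (nd 2 2 (nd 0 2 (nd 3 0 (nd 4 0 (nd (-1) (-1) (lf 12869)
  (lf 12943)) (lf 12920)) (lf 12480)) (lf 11129)) (nd (-2) 2 (lf 10338) (lf 10281))) (nd (-1) 0
  (lf 10366) (lf 10863))) (nd 3 (-1) (lf 8297) (nd 2 2 (lf 8313) (lf 8059)))))) (nd (-1) 1 (nd 2 0
  (nd 0 1 (nd 1 (-1) (nd 2 1 (lf 2627) (nd 3 (-1) (lf 2390) (nd (-1) 2 (lf 3897) (nd (-2) 2
  (nd (-2) 0 (lf 4254) (lf 4138)) (lf 3137))))) (nd (-1) 0 (lf 5447) (nd (-2) 1 (lf 5668)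
  (nd (-2) 2 (lf 6219) (nd 3 1 (lf 6170) (lf 6023)))))) (nd 2 1 (nd 4 0 (lf 9175) (lf 9393))
  (lf 8121))) (nd 0 1 (nd 1 2 (nd (-2) 2 (nd 0 2 (nd 3 (-1) (lf 5260) (lf 5459)) (lf 3942))
  (nd (-2) 1 (nd 3 (-1) (lf 3621) (lf 3894)) (nd (-3) 1 (lf 4784) (lf 4669)))) (nd (-1) 0
  (lf 3523) (lf 2872))) (lf 3166))) (nd 0 1 (nd 2 0 (nd 2 1 (nd (-1) (-1) (nd 1 (-1) (nd 1 2
  (nd (-2) 0 (nd 0 3 (nd 0 2 (nd (-3) 0 (lf 6239) (nd 4 0 (nd 3 (-1) (lf 6282) (lf 6632))
  (nd 3 (-1) (lf 2929) (lf 6920)))) (nd 3 (-1) (nd 4 0 (nd 2 2 (lf 5287) (lf 5104)) (lf 4663))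
  (nd 4 0 (lf 5056) (lf 4866)))) (nd 3 (-1) (nd 4 0 (nd (-2) 1 (lf 5233) (lf 5103)) (lf 4829))
  (nd (-1) 2 (lf 5056) (lf 5169)))) (nd (-2) 1 (lf 5091) (lf 5617))) (nd 0 2 (lf 5513) (lf 5798)))
  (nd (-1) 2 (lf 5511) (lf 5619))) (nd (-2) 1 (nd 1 2 (lf 7208) (lf 7271)) (lf 7091)))
  (nd (-1) (-1) (lf 2399) (lf 4640))) (nd (-1) (-1) (nd 1 0 (lf 5444) (lf 6367)) (nd 2 1 (nd 3 0
  (nd (-1) 0 (nd 2 2 (nd (-2) 0 (lf 6146) (lf 6079)) (lf 6030)) (lf 6289)) (nd (-2) 1 (nd (-2) 0
  (lf 5957) (lf 5921)) (lf 6016))) (nd (-1) 2 (nd 0 2 (nd 3 (-1) (lf 10155) (lf 895)) (lf 0))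
  (lf 3805))))) (nd 2 0 (nd 1 0 (nd (-3) 1 (nd 2 1 (lf 8417) (lf 6840)) (nd 2 1 (lf 9004)
  (lf 6500))) (nd 2 2 (lf 9995) (lf 9830))) (nd 3 1 (nd (-3) 1 (nd 2 2 (lf 6125) (lf 3614))
  (nd (-2) 0 (lf 6225) (lf 6452))) (lf 5521)))))) (nd 1 1 (nd (-1) 1 (nd 2 0 (nd 0 1 (nd (-1) (-1)
  (nd 1 0 (nd 1 2 (lf 15298) (lf 15573)) (nd 3 0 (nd (-1) 2 (lf 15706) (nd 4 0 (lf 14335)
  (nd (-2) 0 (nd 2 1 (lf 14997) (nd 0 2 (lf 14520) (lf 14533))) (lf 15158)))) (lf 15330)))
  (lf 16258)) (nd 1 0 (lf 10255) (lf 11095))) (nd 0 1 (nd (-1) 0 (nd (-3) 1 (nd (-2) 0 (nd 4 0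
  (lf 13956) (lf 13757)) (lf 15274)) (nd (-1) 2 (nd 4 0 (lf 15595) (lf 15322)) (nd (-2) 2
  (lf 14432) (lf 14547)))) (nd 1 2 (lf 15693) (lf 16344))) (lf 16050))) (nd 0 1 (nd 2 0 (nd 1 0
  (nd 2 2 (nd 3 1 (nd (-1) 0 (nd 0 2 (nd (-3) 0 (nd (-2) 0 (nd 3 (-1) (nd 4 0 (lf 15032)
  (lf 15055)) (nd 4 0 (lf 12227) (lf 14906))) (nd 4 0 (nd 3 (-1) (nd (-1) (-1) (lf 13929)
  (lf 14112)) (lf 14553)) (nd 3 (-1) (lf 14159) (lf 14350)))) (nd 4 0 (nd 3 (-1) (nd (-1) 2
  (lf 13983) (lf 14113)) (lf 14387)) (nd (-2) 1 (lf 14159) (lf 14047)))) (nd (-1) 2 (lf 14125)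
  (lf 13599))) (nd (-2) 0 (lf 13703) (lf 13418))) (nd (-2) 1 (lf 13705) (lf 13597))) (nd (-1) 2
  (nd (-1) 0 (lf 12008) (lf 11945)) (lf 12125))) (nd 2 2 (lf 16817) (lf 14576))) (nd 2 2 (nd 2 1
  (lf 13772) (lf 12849)) (nd 1 0 (nd 3 0 (nd 1 2 (nd (-1) (-1) (nd 0 2 (lf 13070) (lf 13137))
  (lf 13186)) (lf 12923)) (nd (-1) 2 (nd 0 2 (lf 13259) (lf 13295)) (lf 13200))) (nd (-2) 1
  (nd 4 0 (lf 21221) (lf 11887)) (lf 15411))))) (nd 2 0 (nd 2 1 (nd (-2) 2 (nd 1 0 (lf 10799)
  (lf 12376)) (nd 1 0 (lf 10212) (lf 12716))) (nd (-1) (-1) (lf 9221) (lf 9386))) (nd 1 (-1)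
  (nd (-2) 2 (nd (-1) (-1) (lf 13091) (lf 15602)) (nd 0 2 (lf 12991) (lf 12764))) (lf 13695)))))
  (nd (-3) 1 (nd (-1) 0 (nd 0 1 (nd 2 0 (nd (-2) 0 (nd 0 2 (nd 3 (-1) (nd (-2) 2 (lf 8780)
  (lf 8958)) (nd (-2) 2 (lf 8815) (lf 9026))) (lf 7220)) (nd 1 2 (lf 9041) (lf 9308))) (nd (-2) 0
  (lf 9431) (nd 0 2 (lf 9740) (lf 10359)))) (nd 2 2 (nd (-1) 2 (nd 3 1 (nd (-2) 0 (lf 9490)
  (lf 9496)) (lf 9406)) (lf 9464)) (lf 8715))) (nd 2 1 (nd 3 0 (lf 12512) (lf 12563)) (lf 11499)))
  (nd 1 2 (nd 0 1 (nd 2 0 (nd (-1) 0 (nd 2 1 (nd 1 0 (lf 7807) (nd 4 0 (lf 8266) (lf 8213)))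
  (lf 7865)) (lf 10698)) (nd 2 1 (nd (-2) 1 (nd (-2) 0 (lf 10559) (lf 10583)) (nd 1 (-1) (nd 0 2
  (lf 10186) (lf 10251)) (lf 10414))) (lf 9643))) (nd (-1) (-1) (lf 9974) (lf 10337))) (nd 1 0
  (nd 1 (-1) (lf 9781) (lf 8901)) (lf 9252))))).

(** The images of (1,0) cover each of the three neighbours twice; those of (1,1) are the six
    vertices at distance 2. *)
Definition hex_flows : seq flow :=
  symmetric_flows (1, 0) adjacent_flow ++ symmetric_flows (1, 1) second_neighbour_flow.

(** The ball of radius 4 in order of distance, followed by the three points at distance 5 whose
    cubic coordinates permute (3,-1,-1). *)
Definition hex_support : seq pos :=
  [:: (0, 0); (1, 0); (0, 1); (-1, 0); (-1, -1); (-1, 1); (-2, 0); (1, 1); (2, 0); (1, -1);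
  (-3, 0); (-2, -1); (-2, 1); (3, 0); (0, -1); (2, -1); (1, 2); (2, 1); (-1, 2); (4, 0); (3, -1);
  (3, 1); (0, 2); (2, 2); (-2, -2); (0, -2); (2, -2); (-4, 0); (-2, 2); (-3, -1); (-3, 1);
  (-4, -1); (4, -1); (0, 3)].

(** Offsets at distance 1 or 2, where (-1,0) and (-2,0) are represented by their inverses. Vertices
    further apart have disjoint closed neighbourhoods, so domination already separates them. *)
Definition hex_pairs : seq pos :=
  [:: (1, 0); (0, 1); (2, 0); (1, 1); (-1, 1); (1, -1); (-1, -1)].

(** Each clause based at [x] has a point within distance 1 of [x], so this box contains the base of
    every clause that fits in the support. *)
Definition hex_region : seq pos :=
  [seq (i, j) | i <- [:: -6; -5; -4; -3; -2; -1; 0; 1; 2; 3; 4; 5; 6],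
                j <- [:: -4; -3; -2; -1; 0; 1; 2; 3; 4]].

Lemma hex_certified :
  certified 80 (Z.mul (Zpos 72) (Zpos 2000)) (Z.mul (Zpos 30) (Zpos 2000))
    hex_pairs hex_region hex_support hex_flows.
(* The cast defers the whole search to a single kernel evaluation at [Qed]. *)
Proof. by vm_cast_no_check (erefl true). Qed.

Lemma hex_flows_bounded : all (fun f => dbounded 21221 f.2) hex_flows.
Proof. by vm_compute. Qed.

Lemma hex_flows_short : all (fun f => f.1 \in walks 2) hex_flows.
Proof. by vm_compute. Qed.

End Certificate.

Theorem theorem1p2 (R : realType) (v : int * int) :
  ((5%:R / 12%:R : R)%R%:E <= min_code_density hex_grid R v)%E.
Proof.
apply: le_ereal_inf_tmp => _ [D Dcode <-].
exact: (certificate_density R v hex_certified hex_flows_bounded hex_flows_short Dcode).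
Qed.
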